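(* In the prosumer based market described in the context (generators $j\in\mathcal G$ bidding $g_j=\alpha_j\lambda$, storage units $i\in\mathcal S$ bidding $u_i=\hat\beta_i\lambda$, inelastic demand $d\in\mathbb R^T$), the competitive equilibrium $(\hat\beta_i,i\in\mathcal S,\ \alpha_j,j\in\mathcal G,\ \lambda)$ is uniquely determined by $$\alpha_j=\frac1{c_j}\quad\forall j\in\mathcal G,\qquad \hat\beta_i=\frac1{b_i}\,\frac{\lambda^T\lambda}{\lambda^TN_{E_i}(\lambda)^TN_{E_i}(\lambda)\lambda}\quad\forall i\in\mathcal S,$$ $$\lambda=\delta d,\qquad \delta^{-1}=\sum_{i\in\mathcal S}\frac1{b_i}\,\frac{d^Td}{d^TN_{E_i}(d)^TN_{E_i}(d)d}+\sum_{j\in\mathcal G}\frac1{c_j}.$$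
   Context: **Storage model.** Fix $T\ge1$. For $u\in\mathbb R^T$ (discharge positive, charge negative) and capacity $E>0$, a state-of-charge (SoC) profile $x=(x_0,\dots,x_T)\in\mathbb R^{T+1}$ satisfies $x_t=x_{t-1}-\frac1E u_t$, i.e. $Ax=-\frac1E u$, where $A\in\mathbb R^{T\times(T+1)}$ has rows $A_{t}=e_{t}^T-e_{t-1}^T$ (columns indexed $0,\dots,T$), $t=1,\dots,T$. **Rainflow.** Given $x$, merge consecutive equal values (keeping the first) and keep the end points and the local extrema (turning points). While there are four consecutive remaining points $p,q,r,s$ with $|x_q-x_r|\le|x_p-x_q|$ and $|x_q-x_r|\le|x_r-x_s|$, take the leftmost such quadruple, record two half-cycles (one full cycle) on the pair $\{q,r\}$, each of depth $|x_q-x_r|$, and delete $q,r$. When no such quadruple remains, record one half-cycle for each pair of consecutive remaining points, with depth the absolute difference of their SoC values. At most $T$ half-cycles are recorded. $\mathrm{Rainflow}(x)=\nu\in\mathbb R^T$ lists the depths, padded with zeros (entries in nonincreasing order, ties in order of extraction). The incidence matrix $M(x)\in\mathbb R^{(T+1)\times T}$ has, for each half-cycle on a pair $\{p,q\}$ with $x_p>x_q$, a column $e_p-e_q$ (columns in the same order as the entries of $\nu$), and zero columns for the padding. So $M(x)^Tx=\nu$. $M(x)$ is unchanged when a constant is added to $x$. Define $N_E(u)=-\frac1E M(x)^TA^\dagger\in\mathbb R^{T\times T}$ ($A^\dagger$ the Moore–Penrose inverse, $x$ any profile with $Ax=-\frac1E u$); then $N_E(u)u=\nu$. The map is used for all vectors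 $u\in\mathbb R^T$, including price vectors and demand vectors. **Prosumer based market.** $\mathcal G,\mathcal S$ are finite sets, not both empty. Generator $j$ has cost $\frac{c_j}{2}g_j^Tg_j$, $c_j>0$, for output $g_j\in\mathbb R^T$. Storage $i$ has capacity $E_i>0$ and degradation cost $\frac{b_i}{2}u_i^TN_{E_i}(u_i)^TN_{E_i}(u_i)u_i$, $b_i>0$, for rate $u_i\in\mathbb R^T$. The demand is $d\in\mathbb R^T$, $d\neq0$. Generators bid scalars $\alpha_j\ge0$ and storage units bid scalars $\hat\beta_i\ge0$. The operator clears the market by minimizing $\sum_{i}\frac1{2\hat\beta_i}u_i^Tu_i+\sum_j\frac1{2\alpha_j}g_j^Tg_j$ subject only to the power balance $d=\sum_jg_j+\sum_iu_i$, whose dual variable $\lambda\in\mathbb R^T$ is the market-clearing price (no other operational constraint is considered); dispatch is $g_j=\alpha_j\lambda$, $u_i=\hat\beta_i\lambda$, and participants are paid $\lambda^Tg_j$, $\lambda^Tu_i$. **Competitive equilibrium.** Participants are price-taking (they treat $\lambda$ as given). $(\hat\beta_i,\alpha_j,\lambda)$ is a competitive equilibrium if: (1) for each $j$, $\alpha_j$ maximizes $\alpha\lambda^T\lambda-\alpha^2\frac{c_j}{2}\lambda^T\lambda$ over $\alpha\ge0$; (2) for each $i$, $\hat\beta_i$ maximizes $\beta\lambda^T\lambda-\frac{b_i\beta^2}{2}\lambda^TN_{E_i}(\beta\lambda)^TN_{E_i}(\beta\lambda)\lambda$ over $\beta\ge0$; (3) demand is met: $d=\sum_j\alpha_j\lambda+\sum_i\hat\beta_i\lambda$.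 *)

(* Defs.v *)
From HB Require Import structures.
From mathcomp Require Import all_boot all_order all_algebra.
Set Implicit Arguments.
Unset Strict Implicit.
Unset Printing Implicit Defensive.
Import Order.TTheory GRing.Theory Num.Theory.
Local Open Scope ring_scope.

(* Moore-Penrose inverse of a real matrix, specified by the four Penrose
   equations. *)

Definition is_pinv (R : realFieldType) (m n : nat)
    (A : 'M[R]_(m, n)) (B : 'M[R]_(n, m)) : bool :=
  [&& A *m B *m A == A, B *m A *m B == B,
      (A *m B)^T == A *m B & (B *m A)^T == B *m A].

Lemma is_pinv_uniq (R : realFieldType) (m n : nat)
    (A : 'M[R]_(m, n)) (B C : 'M[R]_(n, m)) :
  is_pinv A B -> is_pinv A C -> B = C.
Proof.
case/and4P=> /eqP B1 /eqP B2 /eqP B3 /eqP B4.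
case/and4P=> /eqP C1 /eqP C2 /eqP C3 /eqP C4.
have AB_AC : A *m B = A *m C.
  by rewrite -B3 -{1}C1 -(mulmxA (A *m C)) trmx_mul B3 C3 mulmxA B1.
have BA_CA : B *m A = C *m A.
  by rewrite -B4 -{1}C1 -mulmxA mulmxA trmx_mul C4 B4 -mulmxA (mulmxA A) B1.
by rewrite -B2 -mulmxA AB_AC mulmxA BA_CA C2.
Qed.

Lemma row_free_gram_unit (R : realFieldType) (m n : nat) (F : 'M[R]_(m, n)) :
  row_free F -> F *m F^T \in unitmx.
Proof.
move=> Ffree; rewrite -row_free_unit -kermx_eq0; apply/eqP/row_matrixP=> i.
set v := row i _; rewrite row0.
have vG0 : v *m (F *m F^T) = 0.
  by apply: sub_kermxP; apply: row_sub.
have vF0 : v *m F = 0.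
  apply/rowP=> j; rewrite [RHS]mxE.
  have := congr1 (fun M => (M *m v^T) 0 0) vG0.
  rewrite mul0mx mulmxA -mulmxA -trmx_mul !mxE => /eqP.
  rewrite psumr_eq0 => [|k _]; last by rewrite !mxE -expr2 sqr_ge0.
  by move=> /allP/(_ j (mem_index_enum _)); rewrite /= !mxE mulf_eq0 orbb => /eqP.
by apply: (row_free_inj Ffree); rewrite mul0mx.
Qed.

Lemma is_pinv_factor (R : realFieldType) (m n r : nat)
    (C : 'M[R]_(m, r)) (F : 'M[R]_(r, n)) :
  C^T *m C \in unitmx -> F *m F^T \in unitmx ->
  is_pinv (C *m F) (F^T *m invmx (F *m F^T) *m (invmx (C^T *m C) *m C^T)).
Proof.
move=> CU FU; set Fp := F^T *m _; set Cp := _ *m C^T.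
have FFp : F *m Fp = 1%:M by rewrite /Fp mulmxA mulmxV.
have CpC : Cp *m C = 1%:M by rewrite /Cp -mulmxA mulVmx.
have AB : C *m F *m (Fp *m Cp) = C *m Cp.
  by rewrite -mulmxA (mulmxA F) FFp mul1mx.
have BA : Fp *m Cp *m (C *m F) = Fp *m F.
  by rewrite -mulmxA (mulmxA Cp) CpC mul1mx.
apply/and4P; split; apply/eqP.
- by rewrite AB -mulmxA (mulmxA Cp) CpC mul1mx.
- by rewrite BA -mulmxA (mulmxA F) FFp mul1mx.
- by rewrite AB /Cp !(trmx_mul, trmx_inv, trmxK) mulmxA.
- by rewrite BA /Fp !(trmx_mul, trmx_inv, trmxK) mulmxA.
Qed.

Lemma is_pinv_exists (R : realFieldType) (m n : nat) (A : 'M[R]_(m, n)) :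
  exists B, is_pinv A B.
Proof.
have FU : row_base A *m (row_base A)^T \in unitmx.
  by apply: row_free_gram_unit; apply: row_base_free.
have CU : (col_base A)^T *m col_base A \in unitmx.
  rewrite -{2}[col_base A]trmxK; apply: row_free_gram_unit.
  by rewrite /row_free mxrank_tr; apply: col_base_full.
by have := is_pinv_factor CU FU; rewrite mulmx_base => AB; eexists; apply: AB.
Qed.

Definition pinvmp (R : realFieldType) (m n : nat) (A : 'M[R]_(m, n)) :
  'M[R]_(n, m) := xchoose (is_pinv_exists A).

(* State of charge.  Row t : 'I_T stands for the period t + 1, so it reads
   e_(t+1) - e_t in the columns 0, ..., T. *)

Definition soc_mx (R : realFieldType) (T : nat) : 'M[R]_(T, T.+1) :=
  \matrix_(t < T, j < T.+1)
    ((j == t.+1 :> nat)%:R - (j == t :> nat)%:R).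

(* The solution of [soc_mx R T *m x = - E^-1 *: u] with x_0 = 0.  The choice of
   x_0 does not matter: see [rainflow_mxE] below. *)
Definition soc_profile (R : realFieldType) (T : nat) (E : R) (u : 'cV[R]_T) :
  'cV[R]_T.+1 :=
  \col_(j < T.+1) (- E^-1 * \sum_(t < T | (t < j)%N) u t 0).

(* Rainflow counting.  A list of time indices stands for the list of points
   still under consideration, [x] gives their state of charge, and a half-cycle
   is recorded as a pair of time indices. *)

Fixpoint merge_from (R : realFieldType) (I : Type) (x : I -> R)
    (p : I) (s : seq I) : seq I :=
  if s is q :: s' then
    if x q == x p then merge_from x p s' else q :: merge_from x q s'
  else [::].

Definition merge_equal (R : realFieldType) (I : Type) (x : I -> R)
    (s : seq I) : seq I :=
  if s is p :: s' then p :: merge_from x p s' else [::].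

Definition local_extremum (R : realFieldType) (I : Type) (x : I -> R)
    (p q r : I) : bool :=
  (x p < x q) && (x r < x q) || (x q < x p) && (x q < x r).

(* [p] is the point just before [s] in the merged list, kept or not. *)
Fixpoint extrema_from (R : realFieldType) (I : Type) (x : I -> R)
    (p : I) (s : seq I) : seq I :=
  match s with
  | q :: ((r :: _) as s') =>
      if local_extremum x p q r then q :: extrema_from x q s'
      else extrema_from x q s'
  | _ => s
  end.

Definition turning_points (R : realFieldType) (I : Type) (x : I -> R)
    (s : seq I) : seq I :=
  if merge_equal x s is p :: s' then p :: extrema_from x p s' else [::].

(* The middle pair of the leftmost admissible quadruple, with the list of
   points that remain once this pair is deleted. *)
Fixpoint extract_cycle (R : realFieldType) (I : Type) (x : I -> R)
    (l : seq I) : option ((I * I) * seq I) :=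
  match l with
  | p :: ((q :: r :: ((s :: _) as l3)) as l1) =>
      if (`|x q - x r| <= `|x p - x q|) && (`|x q - x r| <= `|x r - x s|)
      then Some ((q, r), p :: l3)
      else if extract_cycle x l1 is Some (c, l') then Some (c, p :: l')
           else None
  | _ => None
  end.

(* The half-cycles in order of extraction.  Each extraction deletes two points,
   so the fuel [size l] used in [half_cycles] is never exhausted. *)
Fixpoint extract_all (R : realFieldType) (I : Type) (x : I -> R)
    (fuel : nat) (l : seq I) : seq (I * I) :=
  if fuel is fuel'.+1 then
    if extract_cycle x l is Some (c, l') then
      c :: c :: extract_all x fuel' l'
    else zip l (behead l)
  else zip l (behead l).

Definition depth (R : realFieldType) (I : Type) (x : I -> R) (c : I * I) : R :=
  `|x c.1 - x c.2|.

(* [sort] is stable, so ties stay in order of extraction. *)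
Definition half_cycles (R : realFieldType) (T : nat) (x : 'cV[R]_T.+1) :
  seq ('I_T.+1 * 'I_T.+1) :=
  let xf := fun t : 'I_T.+1 => x t 0 in
  let l := turning_points xf (enum 'I_T.+1) in
  sort (fun c c' => depth xf c' <= depth xf c) (extract_all xf (size l) l).

(* There are at most T half-cycles (one less than the number of turning
   points), so indexing by k < T truncates nothing. *)
Definition rainflow (R : realFieldType) (T : nat) (x : 'cV[R]_T.+1) : 'cV[R]_T :=
  \col_(k < T) nth 0 [seq depth (fun t => x t 0) c | c <- half_cycles x] k.

Definition half_cycle_col (R : realFieldType) (T : nat) (x : 'cV[R]_T.+1)
    (c : 'I_T.+1 * 'I_T.+1) : 'cV[R]_T.+1 :=
  if x c.2 0 < x c.1 0 then delta_mx c.1 0 - delta_mx c.2 0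
  else delta_mx c.2 0 - delta_mx c.1 0.

Definition incidence_mx (R : realFieldType) (T : nat) (x : 'cV[R]_T.+1) :
  'M[R]_(T.+1, T) :=
  \matrix_(i < T.+1, k < T)
    (nth 0 [seq half_cycle_col x c | c <- half_cycles x] k) i 0.

Definition rainflow_mx (R : realFieldType) (T : nat) (E : R) (u : 'cV[R]_T) :
  'M[R]_T :=
  - E^-1 *: ((incidence_mx (soc_profile E u))^T *m pinvmp (soc_mx R T)).

Lemma pinvmpP (R : realFieldType) (m n : nat) (A : 'M[R]_(m, n)) :
  is_pinv A (pinvmp A).
Proof. exact: xchooseP. Qed.

Lemma soc_mxE (R : realFieldType) (T : nat) (x : 'cV[R]_T.+1) (t : 'I_T) :
  (soc_mx R T *m x) t 0 = x (lift ord0 t) 0 - x (widen_ord (leqnSn T) t) 0.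
Proof.
have pick (k : 'I_T.+1) :
    \sum_(j < T.+1) (j == k :> nat)%:R * x j 0 = x k 0.
  rewrite (bigD1 k) //= eqxx mul1r big1 ?addr0 // => j /negbTE nj.
  by rewrite (nj : (j == k :> nat) = false) mul0r.
rewrite !mxE; under eq_bigr => j _ do rewrite !mxE mulrBl.
by rewrite sumrB -(pick (lift ord0 t)) -(pick (widen_ord _ t)).
Qed.

Lemma soc_profileP (R : realFieldType) (T : nat) (E : R) (u : 'cV[R]_T) :
  soc_mx R T *m soc_profile E u = - E^-1 *: u.
Proof.
apply/colP=> t; rewrite soc_mxE !mxE -mulrBr; congr (_ * _).
apply/eqP; rewrite subr_eq (bigD1 t) ?ltnSn //=; apply/eqP; congr (_ + _).
by apply: eq_bigl => i; rewrite ltnS ltn_neqAle andbC.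
Qed.

Lemma soc_mx_ker (R : realFieldType) (T : nat) (x y : 'cV[R]_T.+1) :
  soc_mx R T *m x = soc_mx R T *m y -> exists a, y = x + const_mx a.
Proof.
move=> Axy; exists (y ord0 0 - x ord0 0); apply/colP => -[k lt_k]; rewrite !mxE.
elim: k lt_k => [|k IH] lt_k.
  have -> : Ordinal lt_k = ord0 by apply: val_inj.
  by rewrite [RHS]addrC subrK.
have := congr1 (fun z : 'cV_T => z (Ordinal (lt_k : (k < T)%N)) 0) Axy.
rewrite /= !soc_mxE.
have -> : lift ord0 (Ordinal (lt_k : (k < T)%N)) = Ordinal lt_k by apply: val_inj.
have -> : widen_ord (leqnSn T) (Ordinal (lt_k : (k < T)%N)) = Ordinal (ltnW lt_k).
  by apply: val_inj.
rewrite IH => /eqP; rewrite eq_sym subr_eq => /eqP ->.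
by rewrite addrA subrK.
Qed.

Lemma extract_cycle4 (R : realFieldType) (I : Type) (x : I -> R)
    (p q r s : I) (l : seq I) :
  extract_cycle x [:: p, q, r, s & l] =
  if (`|x q - x r| <= `|x p - x q|) && (`|x q - x r| <= `|x r - x s|)
  then Some ((q, r), [:: p, s & l])
  else if extract_cycle x [:: q, r, s & l] is Some (c, l')
       then Some (c, p :: l') else None.
Proof. by []. Qed.

Lemma half_cycles_shift (R : realFieldType) (T : nat) (x : 'cV[R]_T.+1) (a : R) :
  half_cycles (x + const_mx a) = half_cycles x.
Proof.
rewrite /half_cycles.
set f := fun t => (x + _) t 0; set g := fun t => x t 0.
have fB i j : f i - f j = g i - g j.
  by rewrite /f /g !mxE opprD addrACA subrr addr0.
have fL i j : (f i < f j) = (g i < g j) by rewrite -subr_lt0 fB subr_lt0.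
have fQ i j : (f i == f j) = (g i == g j) by rewrite -subr_eq0 fB subr_eq0.
have mergeE p l : merge_from f p l = merge_from g p l.
  by elim: l p => //= q l IH p; rewrite fQ !IH.
have extremaE p l : extrema_from f p l = extrema_from g p l.
  elim: l p => //= q l IH p; rewrite !IH /local_extremum.
  by case: l {IH} => // r l; rewrite !fL.
have turningE l : turning_points f l = turning_points g l.
  have -> : turning_points f l =
      if merge_equal g l is p :: s then p :: extrema_from f p s else [::].
    by case: l => // p l; rewrite /turning_points /= mergeE.
  by rewrite /turning_points; case: merge_equal => // p s; rewrite extremaE.
have cycleE l : extract_cycle f l = extract_cycle g l.
  by elim: l => // p [|q [|r [|s l]]] // IH; rewrite !extract_cycle4 !fB IH.
have allE n l : extract_all f n l = extract_all g n l.
  elim: n l => //= n IH l; rewrite cycleE.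
  by case: extract_cycle => // -[c l']; rewrite IH.
rewrite turningE allE -[LHS]map_id -[in RHS](map_id (extract_all _ _ _)).
by apply: map_sort => c c'; rewrite /depth !fB.
Qed.

Lemma incidence_mx_shift (R : realFieldType) (T : nat) (x : 'cV[R]_T.+1) (a : R) :
  incidence_mx (x + const_mx a) = incidence_mx x.
Proof.
apply/matrixP=> i k; rewrite !mxE half_cycles_shift.
suff /eq_map-> : half_cycle_col (x + const_mx a) =1 half_cycle_col x by [].
by move=> c; rewrite /half_cycle_col !mxE ltrD2r.
Qed.

Lemma incidence_mxP (R : realFieldType) (T : nat) (x : 'cV[R]_T.+1) :
  (incidence_mx x)^T *m x = rainflow x.
Proof.
apply/colP=> k; rewrite !mxE.
have deltaE i : ((delta_mx i 0 : 'cV[R]_T.+1)^T *m x) 0 0 = x i 0.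
  by rewrite trmx_delta -rowE mxE.
have deltaB i j :
    ((delta_mx i 0 - delta_mx j 0 : 'cV[R]_T.+1)^T *m x) 0 0 = x i 0 - x j 0.
  by rewrite linearB /= mulmxBl -!deltaE mxE [(- _ : 'M_(_, _)) _ _]mxE.
have colE c : ((half_cycle_col x c)^T *m x) 0 0 = depth (fun t => x t 0) c.
  rewrite /half_cycle_col /depth; case: ltP => h; rewrite deltaB.
    by rewrite gtr0_norm ?subr_gt0.
  by rewrite ler0_norm ?subr_le0 // opprB.
set v := nth 0 [seq half_cycle_col x c | c <- half_cycles x] k.
transitivity ((v^T *m x) 0 0).
  by rewrite !mxE; apply: eq_bigr => i _; rewrite !mxE.
rewrite /v; move: (half_cycles x) (k : nat) => s n.
by elim: s n => [|c s IH] [|n] //=; rewrite ?nth_nil ?trmx0 ?mul0mx ?mxE.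
Qed.

(* Any profile x of u may be used in the definition of N_E(u). *)
Lemma rainflow_mxE (R : realFieldType) (T : nat) (E : R) (u : 'cV[R]_T)
    (x : 'cV[R]_T.+1) :
  soc_mx R T *m x = - E^-1 *: u ->
  rainflow_mx E u = - E^-1 *: ((incidence_mx x)^T *m pinvmp (soc_mx R T)).
Proof.
rewrite -(soc_profileP E u) => /soc_mx_ker[a].
by rewrite /rainflow_mx => ->; rewrite incidence_mx_shift.
Qed.

Lemma rainflow_mxP (R : realFieldType) (T : nat) (E : R) (u : 'cV[R]_T)
    (x : 'cV[R]_T.+1) :
  soc_mx R T *m x = - E^-1 *: u -> rainflow_mx E u *m u = rainflow x.
Proof.
move=> Ax; pose y := pinvmp (soc_mx R T) *m (- E^-1 *: u).
have Ay : soc_mx R T *m y = - E^-1 *: u.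
  by rewrite /y -Ax !mulmxA; have /and4P[/eqP-> _ _ _] := pinvmpP (soc_mx R T).
have -> : rainflow x = rainflow y.
  have [a ->] := soc_mx_ker (etrans Ax (esym Ay)).
  apply/colP=> k; rewrite !mxE half_cycles_shift; congr (nth _ _ _).
  by apply: eq_map => c; rewrite /depth !mxE opprD addrACA subrr addr0.
rewrite (rainflow_mxE Ay) -scalemxAl -mulmxA -incidence_mxP.
by rewrite /y -!scalemxAr.
Qed.

(* Market.  Scalars such as v^T v are the entry of a 1 x 1 matrix product. *)

Definition sqnorm (R : realFieldType) (T : nat) (v : 'cV[R]_T) : R :=
  (v^T *m v) 0 0.

(* v^T N_E(u)^T N_E(u) v *)
Definition cycle_form (R : realFieldType) (T : nat) (E : R) (u v : 'cV[R]_T) : R :=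
  (v^T *m (rainflow_mx E u)^T *m rainflow_mx E u *m v) 0 0.

Definition generator_profit (R : realFieldType) (T : nat) (c : R)
    (lam : 'cV[R]_T) (a : R) : R :=
  a * sqnorm lam - a ^+ 2 * (c / 2) * sqnorm lam.

Definition storage_profit (R : realFieldType) (T : nat) (E b : R)
    (lam : 'cV[R]_T) (beta : R) : R :=
  beta * sqnorm lam - b * beta ^+ 2 / 2 * cycle_form E (beta *: lam) lam.

Definition maximizes_nonneg (R : realFieldType) (f : R -> R) (a : R) : Prop :=
  0 <= a /\ forall a' : R, 0 <= a' -> f a' <= f a.

Definition competitive_equilibrium (R : realFieldType) (T : nat)
    (G S : finType) (c : G -> R) (E b : S -> R) (d : 'cV[R]_T)
    (beta : S -> R) (alpha : G -> R) (lam : 'cV[R]_T) : Prop :=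
  [/\ forall j, maximizes_nonneg (generator_profit (c j) lam) (alpha j),
      forall i, maximizes_nonneg (storage_profit (E i) (b i) lam) (beta i) &
      d = \sum_j alpha j *: lam + \sum_i beta i *: lam].

(* Main.v *)
Require Import Defs.
From mathcomp Require Import all_boot all_order all_algebra reals.
From mathcomp Require Import ring.
Import Order.TTheory GRing.Theory Num.Theory.
Local Open Scope ring_scope.

(** Everything rests on two properties of the map u |-> N_E(u).

    Positive homogeneity of degree zero: rainflow counting only compares state
    of charge values and absolute differences of them, so multiplying a profile
    by a > 0 yields the same half-cycles, and N_E(a u) = N_E(u)
    ([rainflow_mx_scale]).

    Positivity: u <> 0 makes the quadratic form u^T N_E(u)^T N_E(u) u positive
    ([cycle_form_gt0]).  The form is the squared norm of the list of depths, and
    a nonconstant profile has a half-cycle of positive depth: consecutive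
    turning points carry different values, and the half-cycle recorded first
    joins two consecutive turning points.

    Since d <> 0, the power balance forces lam <> 0.  By homogeneity the profit
    of a storage unit, as a function of its bid, is then a genuine quadratic
    k t - (m / 2) t^2 with k, m > 0, just like the profit of a generator, so
    each participant has the single best bid k / m ([maximizes_quadratic]); this
    gives the formulas for alpha and beta.  The power balance reads
    d = s lam, where s is the sum of the bids.  The bids are nonnegative, so s
    is positive and lam is a positive multiple of d.  The bid of a storage unit
    is unchanged when the price is multiplied by a positive number
    ([form_ratio_scale]), so it can be computed at d instead of lam; this turns
    s into an explicit function of d, and delta is its inverse. *)

(** * Invariance of rainflow counting under positive scaling *)

Lemma half_cycles_scale (R : realFieldType) (T : nat) (x : 'cV[R]_T.+1) (a : R) :
  0 < a -> half_cycles (a *: x) = half_cycles x.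
Proof.
move=> a0; rewrite /half_cycles.
set f := fun t => (a *: x) t 0; set g := fun t => x t 0.
have fM i : f i = a * g i by rewrite /f /g mxE.
have fL i j : (f i < f j) = (g i < g j) by rewrite !fM ltr_pM2l.
have fQ i j : (f i == f j) = (g i == g j).
  by rewrite !fM (inj_eq (mulfI (lt0r_neq0 a0))).
have fN i j : `|f i - f j| = a * `|g i - g j|.
  by rewrite !fM -mulrBr normrM (gtr0_norm a0).
have mergeE p l : merge_from f p l = merge_from g p l.
  by elim: l p => //= q l IH p; rewrite fQ !IH.
have extremaE p l : extrema_from f p l = extrema_from g p l.
  elim: l p => //= q l IH p; rewrite !IH /local_extremum.
  by case: l {IH} => // r l; rewrite !fL.
have turningE l : turning_points f l = turning_points g l.
  case: l => // p l; rewrite /turning_points /= mergeE.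
  by rewrite extremaE.
have cycleE l : extract_cycle f l = extract_cycle g l.
  elim: l => // p [|q [|r [|s l]]] // IH.
  by rewrite !extract_cycle4 !fN !ler_pM2l // IH.
have allE n l : extract_all f n l = extract_all g n l.
  elim: n l => //= n IH l; rewrite cycleE.
  by case: extract_cycle => // -[c l']; rewrite IH.
rewrite turningE allE -[LHS]map_id -[in RHS](map_id (extract_all _ _ _)).
by apply: map_sort => c c'; rewrite /depth !fN ler_pM2l.
Qed.

Lemma incidence_mx_scale (R : realFieldType) (T : nat) (x : 'cV[R]_T.+1) (a : R) :
  0 < a -> incidence_mx (a *: x) = incidence_mx x.
Proof.
move=> a0; apply/matrixP=> i k; rewrite !mxE half_cycles_scale //.
suff /eq_map-> : half_cycle_col (a *: x) =1 half_cycle_col x by [].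
by move=> p; rewrite /half_cycle_col !mxE ltr_pM2l.
Qed.

Lemma soc_profile_scale (R : realFieldType) (T : nat) (E a : R) (u : 'cV[R]_T) :
  soc_profile E (a *: u) = a *: soc_profile E u.
Proof.
apply/colP=> j; rewrite !mxE mulrCA; congr (_ * _).
by rewrite mulr_sumr; apply: eq_bigr => t _; rewrite mxE.
Qed.

Lemma rainflow_mx_scale (R : realFieldType) (T : nat) (E a : R) (u : 'cV[R]_T) :
  0 < a -> rainflow_mx E (a *: u) = rainflow_mx E u.
Proof.
by move=> a0; rewrite /rainflow_mx soc_profile_scale incidence_mx_scale.
Qed.

(** * A nonconstant profile has a half-cycle of positive depth *)

Section PositiveDepth.
Variables (R : realFieldType) (I : Type) (x : I -> R).

Let neq : rel I := fun p q => x p != x q.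

Lemma path_merge_from (p : I) (s : seq I) : path neq p (merge_from x p s).
Proof.
elim: s p => //= q s IH p; case: ifP => [_|qp] /=; first exact: IH.
by rewrite IH andbT /neq eq_sym qp.
Qed.

Lemma merge_from_nil (p : I) (s : seq I) :
  merge_from x p s = [::] -> all (fun q => x q == x p) s.
Proof. by elim: s => //= q s IH; case: ifP. Qed.

(** Dropping intermediate points that are not extrema cannot make two kept
    neighbours equal, because the values are strictly monotone from one kept
    point to the next.  Here [k] is the last kept point and [p] the last point
    read; the hypothesis on [k] says that the step from [p] to the head of [s]
    does not reverse the direction from [k] to [p]. *)
Lemma path_extrema_from (k p : I) (s : seq I) :
  path neq p s ->
  (if s is q :: _ then
     (x p < x q -> x k <= x p) /\ (x q < x p -> x p <= x k) else True) ->
  path neq k (extrema_from x p s).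
Proof.
elim: s k p => // q s IH k p /= /andP[pq qs] [up down].
have kq : neq k q.
  move: pq; rewrite /neq; case: (ltgtP (x p) (x q)).
  - by move=> h _; rewrite lt_eqF // (le_lt_trans (up h)).
  - by move=> h _; rewrite gt_eqF // (lt_le_trans h) // down.
  - by [].
case: s IH qs => [|r s] IH qs /=; first by rewrite kq.
case: ifP => [ext|/negbT ext].
  by rewrite /= kq; apply: IH.
apply: IH => //; move: ext pq; rewrite /local_extremum /neq.
case: (ltgtP (x p) (x q)) => //= pq + _.
- rewrite orbF -leNgt => qr; split=> [_|].
    exact: le_trans (up pq) (ltW pq).
  by rewrite ltNge qr.
- rewrite -leNgt => rq; split=> [|_].
    by rewrite ltNge rq.
  exact: le_trans (ltW pq) (down pq).
Qed.

Lemma extrema_from_neq0 (p : I) (s : seq I) :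
  (0 < size s)%N -> (0 < size (extrema_from x p s))%N.
Proof.
by elim: s p => // q [|r s] IH p _ //; rewrite /=; case: ifP => // _; apply: IH.
Qed.

Lemma extract_cycle_neq (l l' : seq I) (e : I * I) :
  sorted neq l -> extract_cycle x l = Some (e, l') -> neq e.1 e.2.
Proof.
elim: l l' => // p [|q [|r [|s l]]] // IH l' /andP[_ sl].
rewrite extract_cycle4; case: ifP => _; first by case=> <- _; case/and3P: sl.
case E: (extract_cycle _ _) => [[f m]|] // [fe _].
by rewrite fe in E; apply: IH sl E.
Qed.

(** It suffices to look at the half-cycle recorded first.  Deleting a pair can
    make two points of equal value neighbours, so the hypothesis on the list is
    not an invariant of the extraction, but it holds when the first pair is
    chosen, and the two points of that pair are neighbours. *)
Lemma extract_all_has_neq (n : nat) (l : seq I) :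
  sorted neq l -> (1 < size l)%N ->
  has (fun e => neq e.1 e.2) (extract_all x n l).
Proof.
move=> sl l2; have hzip : has (fun e => neq e.1 e.2) (zip l (behead l)).
  by case: l sl l2 => // p [|q l] //= /andP[-> _].
case: n => //= n; case E: (extract_cycle _ _) => [[e l']|] //=.
by rewrite (extract_cycle_neq _ _ _ sl E).
Qed.

Lemma turning_points_neq (p : I) (s : seq I) :
  has (fun r => x r != x p) s ->
  sorted neq (turning_points x (p :: s)) /\
  (1 < size (turning_points x (p :: s)))%N.
Proof.
move=> ne; rewrite /turning_points /=; split.
  apply: path_extrema_from; first exact: path_merge_from.
  by case: merge_from.
rewrite ltnS; apply: extrema_from_neq0; case E: merge_from => //.
by have := merge_from_nil _ _ E; move: ne; rewrite has_predC => /negbTE->.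
Qed.

End PositiveDepth.

Lemma rainflow_eq0 (R : realFieldType) (T : nat) (x : 'cV[R]_T.+1) :
  (0 < T)%N -> rainflow x = 0 -> forall t, x t 0 = x ord0 0.
Proof.
move=> T0 r0 t; apply/eqP/negPn/negP => xt.
set f := fun t : 'I_T.+1 => x t 0.
have enumE : enum 'I_T.+1 = ord0 :: behead (enum 'I_T.+1) by rewrite enum_ordSl.
have ne : has (fun r => f r != f ord0) (behead (enum 'I_T.+1)).
  apply/hasP; exists t => //; have := mem_enum 'I_T.+1 t.
  by rewrite enumE inE /= => /orP[/eqP e|//]; rewrite e eqxx in xt.
have [srt sz] := turning_points_neq _ _ f ord0 _ ne.
rewrite -enumE in srt sz.
have /hasP[e eX /negP[]] :=
  extract_all_has_neq _ _ f (size (turning_points f (enum 'I_T.+1))) _ srt sz.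
pose le := fun e e' : 'I_T.+1 * 'I_T.+1 => depth f e' <= depth f e.
have le_tr : transitive le by move=> ? ? ? h h'; apply: le_trans h' h.
have: e \in half_cycles x by rewrite mem_sort; apply: eX.
(* The list is sorted by decreasing depth, so its head bounds all depths. *)
have: sorted le (half_cycles x).
  by apply: sort_sorted => ? ?; rewrite /le le_total.
have := congr1 (fun v : 'cV[R]_T => v (Ordinal T0) 0) r0.
rewrite !mxE -/f; case: (half_cycles x) => //= e1 s e1_0 es e_s.
have: depth f e <= 0.
  move: e_s; rewrite inE -e1_0 => /orP[/eqP->//|].
  exact: (allP (order_path_min le_tr es)).
by rewrite /depth normr_le0 subr_eq0.
Qed.

(** * The degradation form and the best bids *)

Section Forms.
Variables (R : realFieldType) (T : nat).
Implicit Types (u v : 'cV[R]_T) (a E : R).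

Lemma sqnorm_ge0 v : 0 <= sqnorm v.
Proof.
by rewrite /sqnorm mxE; apply: sumr_ge0 => i _; rewrite mxE -expr2 sqr_ge0.
Qed.

Lemma sqnorm_eq0 v : (sqnorm v == 0) = (v == 0).
Proof.
apply/idP/eqP => [|->]; last by rewrite /sqnorm mulmx0 mxE.
rewrite /sqnorm mxE psumr_eq0 => [/allP v0|i _]; last first.
  by rewrite mxE -expr2 sqr_ge0.
apply/colP => i; have := v0 i (mem_index_enum _).
by rewrite /= !mxE mulf_eq0 orbb => /eqP.
Qed.

Lemma sqnorm_gt0 v : (0 < sqnorm v) = (v != 0).
Proof. by rewrite lt0r sqnorm_eq0 sqnorm_ge0 andbT. Qed.

Lemma sqnorm_scale a v : sqnorm (a *: v) = a ^+ 2 * sqnorm v.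
Proof.
rewrite /sqnorm -scalemxAr [(a *: v)^T]linearZ /= -scalemxAl scalerA.
by rewrite mxE expr2.
Qed.

Lemma cycle_formE E u v : cycle_form E u v = sqnorm (rainflow_mx E u *m v).
Proof. by rewrite /cycle_form /sqnorm trmx_mul !mulmxA. Qed.

Lemma cycle_form_scale a E v :
  0 < a -> cycle_form E (a *: v) (a *: v) = a ^+ 2 * cycle_form E v v.
Proof.
by move=> a0; rewrite !cycle_formE rainflow_mx_scale // -scalemxAr sqnorm_scale.
Qed.

Lemma cycle_form_gt0 E u : 0 < E -> u != 0 -> 0 < cycle_form E u u.
Proof.
move=> E0 u0; have Ax := soc_profileP E u.
have /cV0Pn[i _] := u0.
have T0 : (0 < T)%N by apply: leq_ltn_trans (ltn_ord i).
rewrite cycle_formE (rainflow_mxP Ax) sqnorm_gt0; apply: contra_neq u0 => r0.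
have := rainflow_eq0 _ _ _ T0 r0; set x := soc_profile E u in Ax * => xC.
apply: (scalerI (a := - E^-1)); first by rewrite oppr_eq0 invr_eq0 gt_eqF.
by rewrite -Ax scaler0; apply/colP => t; rewrite soc_mxE !xC subrr mxE.
Qed.

Lemma form_ratio_scale a E v : 0 < a ->
  sqnorm (a *: v) / cycle_form E (a *: v) (a *: v) = sqnorm v / cycle_form E v v.
Proof.
move=> a0; rewrite cycle_form_scale // sqnorm_scale.
by rewrite -mulf_div divff ?mul1r // expf_neq0 // gt_eqF.
Qed.

Lemma maximizes_quadratic (f : R -> R) (k m t : R) :
  0 < k -> 0 < m -> (forall s, 0 <= s -> f s = k * s - m / 2 * s ^+ 2) ->
  maximizes_nonneg f t <-> t = k / m.
Proof.
move=> k0 m0 fE; have m_neq0 := lt0r_neq0 m0.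
have best_ge0 : 0 <= k / m by rewrite divr_ge0 // ltW.
have gap s : 0 <= s -> f s = f (k / m) - m / 2 * (s - k / m) ^+ 2.
  by move=> s0; rewrite !fE //; field.
split=> [[t0 /(_ _ best_ge0)]|->]; last first.
  split=> // s s0; rewrite (gap s s0) gerBl.
  by rewrite mulr_ge0 ?sqr_ge0 // divr_ge0 ?ltW.
rewrite (gap t t0) -subr_ge0 [X in 0 <= X]addrC addKr oppr_ge0.
rewrite pmulr_rle0 ?divr_gt0 // => h; apply/eqP; rewrite -subr_eq0.
by rewrite -sqrf_eq0 eq_le h sqr_ge0.
Qed.

Lemma generator_bestP (c alpha : R) v : 0 < c -> v != 0 ->
  maximizes_nonneg (generator_profit c v) alpha <-> alpha = c^-1.
Proof.
rewrite -sqnorm_gt0 => c0 v0; have -> : c^-1 = sqnorm v / (c * sqnorm v).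
  by rewrite invfM mulrCA mulfV ?mulr1 // gt_eqF.
apply: maximizes_quadratic => //; first exact: mulr_gt0.
by move=> s _; rewrite /generator_profit; field.
Qed.

Lemma storage_bestP (E b beta : R) v : 0 < E -> 0 < b -> v != 0 ->
  maximizes_nonneg (storage_profit E b v) beta <->
  beta = b^-1 * (sqnorm v / cycle_form E v v).
Proof.
move=> E0 b0 v0; have q0 := cycle_form_gt0 _ _ E0 v0.
have -> : b^-1 * (sqnorm v / cycle_form E v v) = sqnorm v / (b * cycle_form E v v).
  by rewrite invfM mulrCA.
apply: maximizes_quadratic; rewrite ?sqnorm_gt0 ?mulr_gt0 // => s s0.
(* For s > 0 the matrix N_E(s v) is N_E(v); at s = 0, where it is the matrix of
   the constant profile, the factor s^2 annihilates the degradation cost. *)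
rewrite /storage_profit; case: (ltgtP s 0) s0 => // [s0|->] _; last by field.
by rewrite cycle_formE rainflow_mx_scale // -cycle_formE; field.
Qed.

End Forms.

(** * The competitive equilibrium *)

Theorem theorem1 (R : realType) (T : nat) (T_ge1 : (1 <= T)%N)
    (G S : finType) (GS_neq0 : (0 < #|G| + #|S|)%N)
    (c : G -> R) (c_gt0 : forall j, 0 < c j)
    (E b : S -> R) (E_gt0 : forall i, 0 < E i) (b_gt0 : forall i, 0 < b i)
    (d : 'cV[R]_T) (d_neq0 : d != 0) :
  exists delta : R,
    [/\ delta != 0,
        forall i, cycle_form (E i) d d != 0 &
        forall i, cycle_form (E i) (delta *: d) (delta *: d) != 0] /\
    delta^-1 = \sum_i (b i)^-1 * (sqnorm d / cycle_form (E i) d d)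
               + \sum_j (c j)^-1 /\
    forall (beta : S -> R) (alpha : G -> R) (lam : 'cV[R]_T),
      competitive_equilibrium c E b d beta alpha lam <->
      [/\ forall j, alpha j = (c j)^-1,
          forall i, beta i = (b i)^-1 * (sqnorm lam / cycle_form (E i) lam lam) &
          lam = delta *: d].
Proof.
set bid := fun i => (b i)^-1 * (sqnorm d / cycle_form (E i) d d).
have form_gt0 i v : v != 0 -> 0 < cycle_form (E i) v v by apply: cycle_form_gt0.
have bid_gt0 i : 0 < bid i.
  by rewrite mulr_gt0 ?invr_gt0 // divr_gt0 ?form_gt0 ?sqnorm_gt0.
have cV_gt0 j : 0 < (c j)^-1 by rewrite invr_gt0.
set s := \sum_i bid i + \sum_j (c j)^-1.
have s_gt0 : 0 < s.
  have sS : 0 <= \sum_i bid i by apply: sumr_ge0 => i _; apply: ltW.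
  have sG : 0 <= \sum_j (c j)^-1 by apply: sumr_ge0 => j _; apply: ltW.
  move: GS_neq0; rewrite addn_gt0 => /orP[|] /card_gt0P[i _].
    apply: ltr_wpDl => //; rewrite (bigD1 i) //=.
    by apply: ltr_pwDl => //; apply: sumr_ge0 => j _; apply: ltW.
  apply: ltr_pwDl => //; rewrite (bigD1 i) //=.
  by apply: ltr_pwDl => //; apply: sumr_ge0 => j _; apply: ltW.
have delta_gt0 : 0 < s^-1 by rewrite invr_gt0.
have sd_neq0 : s^-1 *: d != 0 by rewrite scaler_eq0 negb_or gt_eqF.
exists s^-1; split; first by split=> [|i|i]; rewrite gt_eqF ?form_gt0.
split=> [|beta alpha lam]; first by rewrite invrK.
(* At any positive multiple of d, the optimal bids add up to s. *)
have total : (forall j, alpha j = (c j)^-1) ->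
    (forall i, beta i = (b i)^-1 * (sqnorm lam / cycle_form (E i) lam lam)) ->
    forall a, 0 < a -> lam = a *: d ->
    \sum_j alpha j *: lam + \sum_i beta i *: lam = s *: lam.
  move=> alphaE betaE a a0 lamE; rewrite -!scaler_suml -scalerDl addrC.
  rewrite (eq_bigr _ (fun j _ => alphaE j)).
  congr ((_ + _) *: _); apply: eq_bigr => i _.
  by rewrite betaE lamE form_ratio_scale.
split=> [[maxG maxS balance]|[alphaE betaE lamE]].
  have lam_neq0 : lam != 0.
    apply: contra_neq d_neq0 => lam0; rewrite balance lam0.
    by rewrite !big1 ?addr0 // => i _; rewrite scaler0.
  have alphaE j : alpha j = (c j)^-1.
    exact/(generator_bestP _ _ _ _ _ (c_gt0 j) lam_neq0).
  have betaE i : beta i = (b i)^-1 * (sqnorm lam / cycle_form (E i) lam lam).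
    exact/(storage_bestP _ _ _ _ _ _ (E_gt0 i) (b_gt0 i) lam_neq0).
  set a := \sum_j alpha j + \sum_i beta i.
  have dE : d = a *: lam by rewrite scalerDl !scaler_suml.
  have a_neq0 : a != 0 by apply: contra_neq d_neq0 => a0; rewrite dE a0 scale0r.
  have a_gt0 : 0 < a.
    rewrite lt0r a_neq0 addr_ge0 //; apply: sumr_ge0 => i _.
      by have [] := maxG i.
    by have [] := maxS i.
  split=> //; rewrite {1}balance (total alphaE betaE a^-1) ?invr_gt0 //.
    by rewrite scalerA mulVf ?scale1r // gt_eqF.
  by rewrite dE scalerA mulVf ?scale1r.
have lam_neq0 : lam != 0 by rewrite lamE.
split=> [j|i|]; first exact/(generator_bestP _ _ _ _ _ (c_gt0 j) lam_neq0).
  exact/(storage_bestP _ _ _ _ _ _ (E_gt0 i) (b_gt0 i) lam_neq0).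
by rewrite (total alphaE betaE s^-1) // lamE scalerA mulfV ?scale1r // gt_eqF.
Qed.
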